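(* Let $\varepsilon_M>0$ be the machine precision, let $L(n)$ be the (modestly growing) function of the dimension $n$ in the residual error bound (R) of the context, let $A\in\mathbb R^{n\times n}$ be nonsingular, $b\in\mathbb R^n$, $x^{*}=A^{-1}b$, $\omega\in(0,2)$, and let $S$ be a basic linear equation solver satisfying (S) of the context with constant $q\le 0.1$. Assume that $$\varepsilon_M\le 0.01,\qquad L(n)\,\varepsilon_M\,\kappa(A)\le 0.01,\qquad |1-\omega|+\omega q\le 0.6 .$$ Let $\tilde x_0,\tilde x_1,\tilde x_2,\dots$ be the iterates computed in floating point arithmetic by the algorithm IR($\omega$) applied to $Ax=b$ with the solver $S$, under the rounding error model of the context. Then IR($\omega$) is forward stable; namely, there exists $k^{*}$ depending only on $n$ (and not on $A$, $b$, $\omega$, $q$ or $S$) such that for every $k\ge k^{*}$ $$\|\tilde x_k-x^{*}\|\le \bigl(11.6\,L(n)+4.2\bigr)\,\varepsilon_M\,\kappa(A)\,\|x^{*}\| .$$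
   Context: Throughout, $\|\cdot\|$ is the Euclidean norm of vectors and the spectral ($2$-)norm of matrices, and $\kappa(A)=\|A^{-1}\|\,\|A\|$. The machine precision $\varepsilon_M$ and the function $L$ are fixed data of the floating point arithmetic (they do not depend on the particular $A$, $b$, $\omega$). Algorithm IR($\omega$) (Wilkinson's iterative refinement with a relaxation parameter $\omega>0$) for $Ax=b$: let $x_0$ be computed by the solver $S$ applied to $Ax=b$; for $k=0,1,2,\dots$: (1) compute $r_k=b-Ax_k$; (2) solve $Ap_k=r_k$ for $p_k$ by the solver $S$; (3) set $x_{k+1}=x_k+\omega p_k$. Rounding error model. All computations are performed in fixed (working) precision; tildes denote computed quantities ($\tilde x_k,\tilde r_k,\tilde p_k$). (F) Each elementary scalar operation $\diamond\in\{+,-,*,/\}$ on floating point numbers satisfies $f\ell(a\diamond c)=(a\diamond c)(1+\Delta)$ with $|\Delta|\le\varepsilon_M$ (all results are in the normalized range). In step (3) the computed vector is $\tilde x_{k+1}=f\ell(\tilde x_k+f\ell(\omega\tilde p_k))$, with the operations performed componentwise. (S) Whenever $S$ is applied to a system with matrix $A$ and a right-hand side $c$, the computed solution $\tilde y$ satisfies $\|\tilde y-A^{-1}c\|\le q\,\|A^{-1}c\|$, where $0\le q\le 0.1$. In particular $\|\tilde x_0-x^{*}\|\le q\|x^{*}\|$ and $\|\tilde p_k-A^{-1}\tilde r_k\|\le q\|A^{-1}\tilde r_k\|$. (R) The computed residual $\tilde r_k=f\ell(b-A\tilde x_k)$ satisfies $\tilde r_k=b-A\tilde x_k+\Delta r_k$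 with $\|\Delta r_k\|\le L(n)\,\varepsilon_M\,(\|b\|+\|A\|\,\|\tilde x_k\|)$, where $L(n)\ge 0$ depends only on $n$. A computed $\tilde x$ is called a forward stable solution to $Ax=b$ if $\|\tilde x-x^{*}\|\le \mathcal O(\varepsilon_M)\,\kappa(A)\,\|x^{*}\|$, where the constant in $\mathcal O$ may depend on $n$. *)

(* Defs.v *)
From mathcomp Require Import all_boot all_order all_algebra.
From mathcomp Require Import classical_sets reals.

Set Implicit Arguments.
Unset Strict Implicit.
Unset Printing Implicit Defensive.

Import Order.TTheory GRing.Theory Num.Theory.
Local Open Scope ring_scope.
Local Open Scope classical_set_scope.

Definition norm2 {R : realType} {n : nat} (v : 'cV[R]_n) : R :=
  Num.sqrt (\sum_(i < n) v i ord0 ^+ 2).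

(* The norm induced by norm2; the set contains 0 even when n = 0, and it is
   bounded above, so sup is never taken at its default value. *)
Definition spec_norm {R : realType} {n : nat} (A : 'M[R]_n) : R :=
  sup [set norm2 (A *m v) | v in [set v : 'cV[R]_n | norm2 v <= 1]].

Definition cond {R : realType} {n : nat} (A : 'M[R]_n) : R :=
  spec_norm (invmx A) * spec_norm A.

(* y is an admissible computed value of fl(op a c), for a scalar operation op.
   A relation rather than a rounding function: this covers every arithmetic
   satisfying the standard model whose results stay in the normalized range. *)
Definition fl {R : realType} (eps : R) (op : R -> R -> R) (a c y : R) : Prop :=
  exists Delta : R, `|Delta| <= eps /\ y = op a c * (1 + Delta).

(* z is an admissible computed value of fl(x + fl(w p)), componentwise. *)
Definition fl_update {R : realType} {n : nat} (eps w : R)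
    (x p z : 'cV[R]_n) : Prop :=
  forall i : 'I_n, exists t : R,
    fl eps *%R w (p i ord0) t /\ fl eps +%R (x i ord0) t (z i ord0).

(* r is an admissible computed residual; l stands for L(n). *)
Definition fl_residual {R : realType} {n : nat} (eps l : R)
    (A : 'M[R]_n) (b x r : 'cV[R]_n) : Prop :=
  exists dr : 'cV[R]_n, r = b - A *m x + dr /\
    norm2 dr <= l * eps * (norm2 b + spec_norm A * norm2 x).

(* S A c y: the solver S applied to the system with matrix A and right-hand
   side c may return the computed vector y. Deterministic solvers are the
   functional relations. *)
Definition solver (R : realType) (n : nat) : Type :=
  'M[R]_n -> 'cV[R]_n -> 'cV[R]_n -> Prop.

Definition solver_accuracy {R : realType} {n : nat} (S : solver R n)
    (A : 'M[R]_n) (q : R) : Prop :=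
  forall c y : 'cV[R]_n, S A c y ->
    norm2 (y - invmx A *m c) <= q * norm2 (invmx A *m c).

(* x, r, p are the sequences of computed iterates, residuals and corrections of
   an execution of iterative refinement with relaxation parameter w. *)
Record IR_run {R : realType} {n : nat} (eps l : R) (S : solver R n)
    (A : 'M[R]_n) (b : 'cV[R]_n) (w : R) (x r p : nat -> 'cV[R]_n) : Prop := {
  IR_init : S A b (x 0%N);
  IR_residual : forall k : nat, fl_residual eps l A b (x k) (r k);
  IR_solve : forall k : nat, S A (r k) (p k);
  IR_update : forall k : nat, fl_update eps w (x k) (p k) (x k.+1)
}.

(* Forward stability of x as a solution of A x = b, with C the constant in
   O(eps). *)
Definition forward_stable {R : realType} {n : nat} (C eps : R)
    (A : 'M[R]_n) (b x : 'cV[R]_n) : Prop :=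
  norm2 (x - invmx A *m b) <= C * eps * cond A * norm2 (invmx A *m b).

(* Main.v *)
Require Import Defs.
From mathcomp Require Import all_boot all_order all_algebra.
From mathcomp Require Import classical_sets reals.
From mathcomp Require Import ring lra.

(** Write [e_k] for the error [x_k - x*], [u] for [L(n) eps kappa(A)] and [N] for
    [norm2 x*].  In exact arithmetic with a perfect residual, a refinement step
    replaces [e] by [(1 - w) e + w d], where [d] is the solver error, so that the
    error contracts by the factor [|1 - w| + w q <= 0.6].  The floating point
    effects perturb this in three ways:
    - the residual error reaches the correction as [A^-1 dr], whose norm is at
      most [u (2 N + norm2 e)] because [norm2 b <= spec_norm A * N];
    - rounding [w p] costs a relative error [eps] on a vector of size at
      most about [1.6 norm2 e];
    - rounding the sum costs [eps] times the norm of a vector close to [x*].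
    As [u] and [eps] are at most [0.01], the parts proportional to [norm2 e] only
    raise the contraction factor to [0.64], and one step obeys
      [norm2 e_{k+1} <= 0.64 norm2 e_k + (3.3 u + eps) N]
    ([refinement_step]).  The fixed point of this recursion is
    [(3.3 u + eps) N / 0.36], which is below [(9.2 u + 2.8 eps) N].  The initial
    error is at most [0.1 N], so the remaining transient [0.1 * 0.64^k N] is
    absorbed by the gap between [2.8] and [4.2] as soon as [0.64^k <= eps]; this
    fixes the number of steps from [eps] alone.  Finally [N <= kappa(A) N] turns
    the terms in [eps N] into terms in [eps kappa(A) N]. *)

Set Implicit Arguments.
Unset Strict Implicit.
Unset Printing Implicit Defensive.

Import Order.TTheory GRing.Theory Num.Theory.
Local Open Scope ring_scope.

(** * The Euclidean norm *)

Section EuclideanNorm.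
Variables (R : realType) (n : nat).
Implicit Types (u v : 'cV[R]_n) (a c : R).

Lemma sum_sqr_ge0 v : 0 <= \sum_(i < n) v i ord0 ^+ 2.
Proof. by apply: sumr_ge0 => i _; exact: sqr_ge0. Qed.

Lemma norm2_ge0 v : 0 <= norm2 v.
Proof. exact: sqrtr_ge0. Qed.

Lemma sqr_norm2 v : norm2 v ^+ 2 = \sum_(i < n) v i ord0 ^+ 2.
Proof. by rewrite sqr_sqrtr ?sum_sqr_ge0. Qed.

Lemma norm2_le_sqr v c :
  0 <= c -> \sum_(i < n) v i ord0 ^+ 2 <= c ^+ 2 -> norm2 v <= c.
Proof.
by move=> c0 h; rewrite -(@ler_pXn2r _ 2) ?nnegrE ?norm2_ge0 // sqr_norm2.
Qed.

Lemma norm2_le_pointwise u v c : 0 <= c ->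
  (forall i, `|u i ord0| <= c * `|v i ord0|) -> norm2 u <= c * norm2 v.
Proof.
move=> c0 h; apply: norm2_le_sqr; first by rewrite mulr_ge0 ?norm2_ge0.
rewrite exprMn sqr_norm2 mulr_sumr; apply: ler_sum => i _.
rewrite -(real_normK (num_real (u i ord0))) -(real_normK (num_real (v i ord0))).
by rewrite -exprMn ler_pXn2r ?nnegrE ?mulr_ge0.
Qed.

Lemma norm2Z a v : norm2 (a *: v) = `|a| * norm2 v.
Proof.
rewrite /norm2 -sqrtr_sqr -sqrtrM ?sqr_ge0 // mulr_sumr.
by congr Num.sqrt; apply: eq_bigr => i _; rewrite mxE exprMn.
Qed.

Lemma norm2N v : norm2 (- v) = norm2 v.
Proof. by rewrite -scaleN1r norm2Z normrN1 mul1r. Qed.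

Lemma norm2_eq0 v : norm2 v = 0 -> v = 0.
Proof.
move=> v0; have := sqr_norm2 v; rewrite v0 expr0n /= => /esym/eqP.
rewrite psumr_eq0 => [/allP h|i _]; last exact: sqr_ge0.
apply/matrixP => i j; rewrite ord1 mxE; apply/eqP.
by rewrite -sqrf_eq0; apply: (h i); rewrite mem_index_enum.
Qed.

(** Summing the inequality [2 (s u_i) (t v_i) <= (s u_i)^2 + (t v_i)^2] with
    [s = norm2 v] and [t = norm2 u] gives the bound multiplied by
    [2 * norm2 u * norm2 v]. *)
Lemma cauchy_schwarz u v :
  \sum_(i < n) u i ord0 * v i ord0 <= norm2 u * norm2 v.
Proof.
have [/norm2_eq0 ->|u0] := eqVneq (norm2 u) 0.
  rewrite big1 ?mulr_ge0 ?norm2_ge0 // => i _.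
  by rewrite mxE mul0r.
have [/norm2_eq0 ->|v0] := eqVneq (norm2 v) 0.
  rewrite big1 ?mulr_ge0 ?norm2_ge0 // => i _.
  by rewrite mxE mulr0.
have uv_gt0 : 0 < norm2 u * norm2 v *+ 2.
  by rewrite mulrn_wgt0 // mulr_gt0 // lt_def ?u0 ?v0 norm2_ge0.
rewrite -(ler_pM2l uv_gt0) mulr_sumr.
apply: (@le_trans _ _ (\sum_(i < n) (norm2 v ^+ 2 * u i ord0 ^+ 2
                                     + norm2 u ^+ 2 * v i ord0 ^+ 2))).
  apply: ler_sum => i _.
  have := sqr_ge0 (norm2 v * u i ord0 - norm2 u * v i ord0); lra.
rewrite big_split /= -!mulr_sumr -!sqr_norm2; lra.
Qed.

Lemma ler_norm2D u v : norm2 (u + v) <= norm2 u + norm2 v.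
Proof.
apply: norm2_le_sqr; first by rewrite addr_ge0 ?norm2_ge0.
rewrite sqrrD !sqr_norm2.
under eq_bigr => i _ do rewrite mxE sqrrD.
rewrite !big_split /= -mulr2n lerD2r lerD2l lerMn2r /=.
exact: cauchy_schwarz.
Qed.

End EuclideanNorm.

(** * The spectral norm *)

Section SpectralNorm.
Variables (R : realType) (n : nat).
Implicit Types (M : 'M[R]_n) (v : 'cV[R]_n).

(** The Frobenius norm serves as the upper bound that makes the supremum in
    [spec_norm] meaningful. *)
Lemma norm2_mulmx_frobenius M v :
  norm2 (M *m v) <= Num.sqrt (\sum_(i < n) norm2 (row i M)^T ^+ 2) * norm2 v.
Proof.
apply: norm2_le_sqr; first by rewrite mulr_ge0 ?sqrtr_ge0 ?norm2_ge0.
rewrite exprMn sqr_sqrtr ?sumr_ge0 // => [|i _]; last exact: sqr_ge0.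
rewrite mulr_suml; apply: ler_sum => i _; rewrite -exprMn.
have eM w : (M *m w) i ord0 = \sum_(j < n) (row i M)^T j ord0 * w j ord0.
  by rewrite mxE; apply: eq_bigr => j _; rewrite !mxE.
have le1 := cauchy_schwarz (row i M)^T v; rewrite -eM in le1.
have := cauchy_schwarz (row i M)^T (- v); rewrite -eM norm2N mulmxN mxE => le2.
rewrite -(real_normK (num_real ((M *m v) i ord0))).
rewrite ler_pXn2r ?nnegrE ?mulr_ge0 ?norm2_ge0 //.
by rewrite ler_norml le1 andbT lerNl.
Qed.

Lemma spec_norm_has_ubound M : has_ubound
  [set norm2 (M *m v) | v in [set v : 'cV[R]_n | norm2 v <= 1]]%classic.
Proof.
exists (Num.sqrt (\sum_(i < n) norm2 (row i M)^T ^+ 2)) => _ [v /= v1 <-].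
by apply: le_trans (norm2_mulmx_frobenius _ _) _; rewrite ler_piMr ?sqrtr_ge0.
Qed.

Lemma norm2_mulmx M v : norm2 (M *m v) <= spec_norm M * norm2 v.
Proof.
have [v0|v0] := eqVneq (norm2 v) 0.
  by rewrite v0 (norm2_eq0 v0) mulmx0 mulr0 -(scale0r v) norm2Z normr0 mul0r.
have v_gt0 : 0 < norm2 v by rewrite lt_def v0 norm2_ge0.
rewrite -ler_pdivrMr //.
have -> : norm2 (M *m v) / norm2 v = norm2 (M *m ((norm2 v)^-1 *: v)).
  by rewrite -scalemxAr norm2Z ger0_norm ?invr_ge0 ?norm2_ge0 // mulrC.
apply: (ub_le_sup (spec_norm_has_ubound M)).
exists ((norm2 v)^-1 *: v) => //=.
by rewrite norm2Z ger0_norm ?invr_ge0 ?norm2_ge0 // mulVf.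
Qed.

Lemma spec_norm_ge0 M : 0 <= spec_norm M.
Proof.
apply: (le_trans (norm2_ge0 (M *m 0))).
apply: (ub_le_sup (spec_norm_has_ubound M)); exists 0 => //=.
by rewrite -(scale0r (0 : 'cV[R]_n)) norm2Z normr0 mul0r ler01.
Qed.

Lemma cond_ge0 M : 0 <= cond M.
Proof. by rewrite mulr_ge0 ?spec_norm_ge0. Qed.

(** This form of [1 <= cond M] also covers dimension [0], where [cond M = 0]. *)
Lemma norm2_le_cond M v : M \in unitmx -> norm2 v <= cond M * norm2 v.
Proof.
move=> uM; rewrite -[in leLHS](mulKmx uM v) -mulrA.
apply: le_trans (norm2_mulmx _ _) _.
by rewrite ler_wpM2l ?spec_norm_ge0 ?norm2_mulmx.
Qed.

End SpectralNorm.

(** * One step of the iteration *)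

(** The two roundings of the update are separated, so that each can be measured
    relative to the vector it acts on. *)
Lemma fl_updateP (R : realType) (n : nat) (eps w : R) (x p z : 'cV[R]_n) :
  0 <= eps -> 0 <= w -> fl_update eps w x p z ->
  exists t : 'cV[R]_n, norm2 (t - w *: p) <= eps * (w * norm2 p) /\
    norm2 (z - (x + t)) <= eps * norm2 (x + t).
Proof.
move=> eps0 w0 /fin_all_exists[f hf]; exists (\col_i f i); split.
  rewrite -{2}(ger0_norm w0) -norm2Z; apply: norm2_le_pointwise => // i.
  rewrite !mxE; have [[d [hd ->]] _] := hf i.
  have -> : w * p i ord0 * (1 + d) - w * p i ord0 = d * (w * p i ord0) by ring.
  by rewrite normrM ler_wpM2r.
apply: norm2_le_pointwise => // i; rewrite !mxE.
have [_ [d [hd ->]]] := hf i.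
have -> : (x i ord0 + f i) * (1 + d) - (x i ord0 + f i) =
  d * (x i ord0 + f i) by ring.
by rewrite normrM ler_wpM2r.
Qed.

(** The factor [2] comes from [norm2 b] and from the [x*] part of [norm2 x],
    each of which contributes at most [spec_norm A * norm2 xs]. *)
Lemma norm2_invmx_residual_error (R : realType) (n : nat) (eps l : R)
    (A : 'M[R]_n) (xs x dr : 'cV[R]_n) :
  0 <= eps -> 0 <= l ->
  norm2 dr <= l * eps * (norm2 (A *m xs) + spec_norm A * norm2 x) ->
  norm2 (invmx A *m dr) <=
    l * eps * cond A * (2 * norm2 xs + norm2 (x - xs)).
Proof.
move=> eps0 l0 hdr; apply: le_trans (norm2_mulmx _ _) _.
have -> : l * eps * cond A * (2 * norm2 xs + norm2 (x - xs)) =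
  spec_norm (invmx A) *
    (l * eps * (spec_norm A * norm2 xs +
                spec_norm A * (norm2 xs + norm2 (x - xs)))).
  by rewrite /cond; ring.
apply: ler_wpM2l; first exact: spec_norm_ge0.
apply: le_trans hdr _; apply: ler_wpM2l; first exact: mulr_ge0.
apply: lerD; first exact: norm2_mulmx.
apply: ler_wpM2l; first exact: spec_norm_ge0.
by rewrite -{1}(subrKC xs x) ler_norm2D.
Qed.

(** The triangle inequalities of [refinement_step], reduced to real numbers:
    [E], [D], [P], [T], [G], [F] stand for the norms of the old error, the
    propagated residual error, the computed correction, the rounding error of
    [w p], the error before the last rounding, and the new error. *)
Lemma refinement_step_bound (R : realType) (eps u w q N E D P T G F : R) :
  0 <= eps <= 1 / 100 -> 0 <= u <= 1 / 100 ->
  0 < w -> 0 <= q <= 1 / 10 -> `|1 - w| + w * q <= 6 / 10 ->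
  0 <= N -> 0 <= E -> 0 <= D ->
  D <= u * (2 * N + E) ->
  P <= (1 + q) * (E + D) ->
  T <= eps * (w * P) ->
  G <= `|1 - w| * E + w * D + w * (q * (E + D)) + T ->
  F <= G + eps * (N + G) ->
  F <= 64 / 100 * E + (33 / 10 * u + eps) * N.
Proof.
move=> /andP[e0 e1] /andP[u0 u1] w0 /andP[q0 q1] hw N0 E0 D0 hD hP hT hG hF.
(* The contraction hypothesis bounds w (1 + q): use |1 - w| >= w - 1. *)
have hwq : w * (1 + q) <= 16 / 10.
  have := ler_norm (w - 1); rewrite distrC; lra.
have hwP : w * P <= 16 / 10 * (E + D).
  apply: (@le_trans _ _ (w * ((1 + q) * (E + D)))).
    by rewrite ler_wpM2l // ltW.
  by rewrite mulrA ler_wpM2r // addr_ge0.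
have hT' : T <= eps * (16 / 10 * (E + D)).
  by apply: le_trans hT _; rewrite ler_wpM2l.
have hE : (`|1 - w| + w * q) * E <= 6 / 10 * E by rewrite ler_wpM2r.
have hDw : w * (1 + q) * D <= 16 / 10 * D by rewrite ler_wpM2r.
have heE : eps * E <= 1 / 100 * E by rewrite ler_wpM2r.
have heD : eps * D <= 1 / 100 * D by rewrite ler_wpM2r.
have huE : u * E <= 1 / 100 * E by rewrite ler_wpM2r.
have huN0 : 0 <= u * N by rewrite mulr_ge0.
(* 0.616 = 0.6 + 1.6 * 0.01 and 1.616 = 1.6 + 1.6 * 0.01, using eps <= 0.01. *)
set G' := 616 / 1000 * E + 1616 / 1000 * D.
have hG' : G <= G' by rewrite /G'; lra.
have G'0 : 0 <= G' by rewrite /G'; lra.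
have heG : eps * G <= 1 / 100 * G'.
  by apply: (le_trans (ler_wpM2l e0 hG')); rewrite ler_wpM2r.
rewrite /G' in hG' heG; lra.
Qed.

Lemma refinement_step (R : realType) (n : nat) (eps l w q : R)
    (S : solver R n) (A : 'M[R]_n) (xs x r p z : 'cV[R]_n) :
  0 <= eps <= 1 / 100 -> 0 <= l -> l * eps * cond A <= 1 / 100 ->
  A \in unitmx -> 0 < w -> 0 <= q <= 1 / 10 -> `|1 - w| + w * q <= 6 / 10 ->
  solver_accuracy S A q ->
  fl_residual eps l A (A *m xs) x r -> S A r p -> fl_update eps w x p z ->
  norm2 (z - xs) <= 64 / 100 * norm2 (x - xs) +
    (33 / 10 * (l * eps * cond A) + eps) * norm2 xs.
Proof.
move=> heps l0 hu uA w0 hq hw hS [dr [er hdr]] /hS hp hz.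
have /andP[e0 _] := heps; have /andP[q0 _] := hq.
have [t [hT hF]] := fl_updateP e0 (ltW w0) hz.
have hD := norm2_invmx_residual_error e0 l0 hdr.
set e := x - xs in hD *; set a := invmx A *m dr in hD *.
have er' : invmx A *m r = a - e.
  rewrite er -mulmxBr mulmxDr mulKmx // -/a /e.
  by rewrite opprB addrC.
rewrite er' in hp; set d := p - (a - e) in hp.
have hae : norm2 (a - e) <= norm2 e + norm2 a.
  by rewrite addrC -[norm2 e]norm2N ler_norm2D.
have hd : norm2 d <= q * (norm2 e + norm2 a).
  by apply: le_trans hp _; rewrite ler_wpM2l.
have u0 : 0 <= l * eps * cond A by rewrite mulr_ge0 ?cond_ge0 // mulr_ge0.
have hP : norm2 p <= (1 + q) * (norm2 e + norm2 a).
  rewrite -[p](subrK (a - e)) -/d.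
  by apply: le_trans (ler_norm2D _ _) _; lra.
apply: (@refinement_step_bound _ eps _ w q _ _ (norm2 a) (norm2 p)
  (norm2 (t - w *: p)) (norm2 (x + t - xs))) => //; rewrite ?norm2_ge0 ?u0 //.
- have -> : x + t - xs = (1 - w) *: e + w *: a + w *: d + (t - w *: p).
    rewrite /d /e; apply/matrixP => i j; rewrite !mxE; ring.
  apply: le_trans (ler_norm2D _ _) _; rewrite lerD2r.
  apply: le_trans (ler_norm2D _ _) _; apply: lerD.
    apply: le_trans (ler_norm2D _ _) _.
    by rewrite !norm2Z (gtr0_norm w0).
  by rewrite norm2Z gtr0_norm // ler_pM2l.
- have -> : z - xs = (x + t - xs) + (z - (x + t)).
    by apply/matrixP => i j; rewrite !mxE; ring.
  apply: le_trans (ler_norm2D _ _) _; rewrite lerD2l.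
  apply: le_trans hF _; apply: ler_wpM2l => //.
  by rewrite -{1}(subrKC xs (x + t)) ler_norm2D.
Qed.

(** * The iteration *)

(** The bound is exact for the recursion with equality, whose fixed point is
    [c]: the distance to [c] shrinks by [a] at each step. *)
Lemma affine_recursion_bound (R : realType) (a c : R) (f : nat -> R) :
  0 <= a -> (forall k, f k.+1 <= a * f k + (1 - a) * c) ->
  forall k, f k <= a ^+ k * (f 0%N - c) + c.
Proof.
move=> a0 hf; elim=> [|k IH]; first by rewrite expr0; lra.
apply: le_trans (hf k) _; rewrite exprS.
have := ler_wpM2l a0 IH; lra.
Qed.

(** Two steps contract by more than a half. *)
Lemma contraction_eventually_le (R : realType) (eps : R) (k : nat) :
  0 < eps -> ((Num.bound eps^-1).*2 <= k)%N -> (64 / 100 : R) ^+ k <= eps.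
Proof.
move=> eps0; set m := Num.bound _ => mk.
have h0 : 0 <= (64 / 100 : R) by lra.
apply: (@le_trans _ _ ((64 / 100 : R) ^+ m.*2)).
  by apply: ler_wiXn2l mk => //; lra.
rewrite -mul2n exprM; apply: (@le_trans _ _ ((2^-1 : R) ^+ m)).
  by apply: lerXn2r; rewrite ?nnegrE; lra.
have m2 : eps^-1 < 2 ^+ m by apply: upper_nthrootP.
by rewrite exprVn -[leRHS]invrK lef_pV2 ?posrE ?invr_gt0 ?exprn_gt0 // ltW.
Qed.

Theorem theorem2p1 (R : realType) (eps : R) (L : nat -> R)
    (eps_gt0 : 0 < eps) (L_ge0 : forall m : nat, 0 <= L m)
    (eps_small : eps <= 1 / 100) :
  exists kstar : nat -> nat,
    forall (n : nat) (A : 'M[R]_n) (b : 'cV[R]_n) (w q : R) (S : solver R n)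
      (x r p : nat -> 'cV[R]_n),
    A \in unitmx ->
    0 < w < 2 ->
    0 <= q <= 1 / 10 ->
    solver_accuracy S A q ->
    L n * eps * cond A <= 1 / 100 ->
    `|1 - w| + w * q <= 6 / 10 ->
    IR_run eps (L n) S A b w x r p ->
    forall k : nat, (kstar n <= k)%N ->
      forward_stable (116 / 10 * L n + 42 / 10) eps A b (x k).
Proof.
exists (fun=> (Num.bound eps^-1).*2).
move=> n A b w q S x r p uA /andP[w0 _] hq hS hu hw [x0 hr hp hx] k hk.
have heps : 0 <= eps <= 1 / 100 by rewrite eps_small ltW.
rewrite /forward_stable; set xs := invmx A *m b.
have eb : b = A *m xs by rewrite mulKVmx.
set N := norm2 xs; set u := L n * eps * cond A in hu.
have N0 : 0 <= N by exact: norm2_ge0.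
have u0 : 0 <= u by rewrite /u mulr_ge0 ?cond_ge0 // mulr_ge0 // ltW.
pose c := (33 / 10 * u + eps) * N / (36 / 100).
have step j : norm2 (x j.+1 - xs) <=
    64 / 100 * norm2 (x j - xs) + (1 - 64 / 100) * c.
  have := hr j; rewrite eb => hrj.
  have -> : (1 - 64 / 100) * c = (33 / 10 * u + eps) * N by rewrite /c; field.
  exact: (refinement_step heps (L_ge0 n) hu uA w0 hq hw hS hrj (hp j) (hx j)).
have c0 : 0 <= c by rewrite /c divr_ge0 // mulr_ge0 //; lra.
have init : norm2 (x 0%N - xs) <= 1 / 10 * N.
  apply: le_trans (hS _ _ x0) _; apply: ler_wpM2r => //.
  by case/andP: hq.
have rate_ge0 : 0 <= (64 / 100 : R) by lra.
have hE := affine_recursion_bound rate_ge0 step k.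
have transient : (64 / 100) ^+ k * (norm2 (x 0%N - xs) - c) <= eps * (1 / 10 * N).
  apply: (@le_trans _ _ ((64 / 100) ^+ k * (1 / 10 * N))).
    by apply: ler_wpM2l; [exact: exprn_ge0 | lra].
  apply: ler_wpM2r; [lra | exact: contraction_eventually_le].
have epsN : eps * N <= eps * (cond A * N).
  by rewrite ler_wpM2l ?norm2_le_cond // ltW.
have uN : 0 <= u * N by rewrite mulr_ge0.
have eN : 0 <= eps * N by rewrite mulr_ge0 // ltW.
have -> : (116 / 10 * L n + 42 / 10) * eps * cond A * N =
  116 / 10 * (u * N) + 42 / 10 * (eps * (cond A * N)) by rewrite /u; ring.
have ec : c = 330 / 36 * (u * N) + 100 / 36 * (eps * N) by rewrite /c; field.
lra.
Qed.
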